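(* Let $\varepsilon \in (0,1)$, $n_1, n_2 \in \mathbb{N}$, and $r = \lceil 9 \log(3 n_1 n_2)/\varepsilon^2 \rceil$. Let $\sigma, R > 0$, let $\Omega \subset \mathbb{R}$ be an interval with $[-\sigma R^2, \sigma R^2] \subseteq \Omega$, and let $h : \Omega \to \mathbb{R}$ be a bounded function in $C^\infty(\Omega)$ such that, for some constants $C \geq 0$ and $M > 0$, $\|h^{(s)}\|_{L_\infty(\Omega)} \leq C M^s$ for all $s \in \mathbb{N}_0$. Let $m \in \mathbb{N}$ and let $W \in \mathbb{R}^{m \times m}$ be symmetric positive-definite with $\|W\|_2 \leq \sigma$. Then for every matrix $F \in \mathbb{R}^{n_1 \times n_2}$ of the form $F(i,j) = h(x_i^\top W y_j)$ with points $\{x_i\}_{i=1}^{n_1}, \{y_j\}_{j=1}^{n_2} \subset \overline{\mathbb{B}}_{m,R}$, and for every integer $t \geq e^2 M \|W\|_2 R^2$, there exists $G \in \mathbb{R}^{n_1 \times n_2}$ with $\mathrm{rank}(G) \leq 1 + (t-1) r$ such that $$\|F - G\|_{\max} \leq C \left[ e^{-t} + \varepsilon \left( e^{M \|W\|_2 R^2} - 1 \right) \right].$$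
   Context: $\mathbb{N} = \{1,2,\ldots\}$ and $\mathbb{N}_0 = \{0,1,2,\ldots\}$; $\log$ is the natural logarithm and $e$ is Euler's number. $\|F\|_{\max} = \max_{i,j} |F(i,j)|$; $\|W\|_2$ is the spectral norm; $\overline{\mathbb{B}}_{m,R} = \{x \in \mathbb{R}^m : \|x\|_2 \leq R\}$. For a function $g$ on $\Omega$, $\|g\|_{L_\infty(\Omega)} = \sup_{x \in \Omega} |g(x)|$, and $h^{(s)}$ is the $s$-th derivative of $h$. *)

(* Defs.v *)
From HB Require Import structures.
From mathcomp Require Import all_boot all_order all_algebra.
From mathcomp Require Import all_classical all_reals all_analysis.

Set Implicit Arguments.
Unset Strict Implicit.
Unset Printing Implicit Defensive.

Import Order.TTheory GRing.Theory Num.Theory.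
Import numFieldNormedType.Exports.

Local Open Scope classical_set_scope.
Local Open Scope ring_scope.

(* The norm `|x| that the library puts on matrices is the max norm [mx_norm],
   so the Euclidean norm has to be introduced separately. *)
Definition l2norm (R : realType) (m : nat) (x : 'cV[R]_m) : R :=
  Num.sqrt (\sum_(i < m) x i 0 ^+ 2).

Definition l2closed_ball (R : realType) (m : nat) (rho : R) : set 'cV[R]_m :=
  [set x | l2norm x <= rho].

(* Operator norm induced by the Euclidean norm; the set is bounded and contains
   0, so the real-valued [sup] is a genuine supremum. *)
Definition spectral_norm (R : realType) (m n : nat) (A : 'M[R]_(m, n)) : R :=
  sup [set l2norm (A *m x) | x in @l2closed_ball R n 1].

Definition symposdef (R : realType) (m : nat) (W : 'M[R]_m) : Prop :=
  W^T = W /\ forall x : 'cV[R]_m, x != 0 -> 0 < (x^T *m W *m x) 0 0.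

(* Functions on Omega are represented by total functions R -> R. At x in Omega
   the difference quotients only involve points y != x of Omega, so values
   outside Omega are irrelevant, and at an endpoint belonging to Omega the
   derivative is the one-sided one. *)
Definition diff_quot (R : realType) (f : R -> R) (x : R) : R -> R :=
  fun y => (f y - f x) / (y - x).

Definition derivable_on (R : realType) (Omega : set R) (f : R -> R) (x : R) :
    Prop :=
  cvg (diff_quot f x y @[y --> within Omega x^']).

Definition derive_on (R : realType) (Omega : set R) (f : R -> R) : R -> R :=
  fun x => lim (diff_quot f x y @[y --> within Omega x^']).

Definition derive_onn (R : realType) (Omega : set R) (s : nat) (f : R -> R) :
    R -> R :=
  iter s (derive_on Omega) f.

Definition smooth_on (R : realType) (Omega : set R) (f : R -> R) : Prop :=
  forall (s : nat) (x : R), Omega x ->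
    derivable_on Omega (derive_onn Omega s f) x.

(* Extended-real valued, so that an unbounded function has norm +oo. *)
Definition Linfty_norm (R : realType) (Omega : set R) (g : R -> R) : \bar R :=
  ereal_sup [set `|g x|%:E | x in Omega].

(* Main.v *)
(* The Taylor polynomial of [h] of degree [t - 1] approximates [h] up to
   [C * (M * |W| * rho ^ 2) ^ t / t! <= C * exp (- t)]. Its [s]-th power
   [(x_i^T W y_j) ^ s] is the inner product of the tensor powers of [x_i] and
   [W y_j], so for [s >= 1] a Johnson-Lindenstrauss projection with [r] random
   sign vectors replaces it by a matrix of rank at most [r] up to
   [eps * (|W| * rho ^ 2) ^ s]; the constant term has rank at most 1. The sign
   vectors are chosen one at a time so as not to increase an exponential
   potential, which needs only the expectation over a single sign vector. *)

Require Import Defs.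
From HB Require Import structures.
From mathcomp Require Import all_boot all_order all_algebra.
From mathcomp Require Import all_classical all_reals all_analysis.
From mathcomp Require Import ring lra.

Set Implicit Arguments.
Unset Strict Implicit.
Unset Printing Implicit Defensive.

Import Order.TTheory GRing.Theory Num.Theory.
Import numFieldNormedType.Exports.

Local Open Scope classical_set_scope.
Local Open Scope ring_scope.

(** * Monotonicity from the sign of the derivative, and the sub-Gaussian bound for one sign *)

Lemma ge0_derive_le (R : realType) (f df : R -> R) (z : R) : 0 <= z ->
  (forall x : R, x \in `]0, z[ -> is_derive x 1 f (df x)) ->
  {within `[0, z], continuous f} ->
  (forall x, x \in `]0, z[ -> 0 <= df x) -> f 0 <= f z.
Proof.
rewrite le_eqVlt => /predU1P[<- //|z0 dfE cf df0].
have [c cz e] := MVT z0 dfE cf.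
by rewrite -subr_ge0 e mulr_ge0 ?df0// subr0 ltW.
Qed.

Lemma ge0_derive_leT (R : realType) (f df : R -> R) (z : R) : 0 <= z ->
  (forall x : R, is_derive x 1 f (df x)) ->
  (forall x, 0 <= x -> 0 <= df x) -> f 0 <= f z.
Proof.
move=> z0 dfE df0; apply: (@ge0_derive_le _ f df) => // [|x].
  apply: continuous_subspaceT => x.
  by apply: differentiable_continuous; apply/derivable1_diffP; case: (dfE x).
by rewrite in_itv => /andP[x0 _]; rewrite df0// ltW.
Qed.

(** After division by [expR (x ^+ 2 / 2)] the claim is [0 <= g x], where [g] vanishes at 0 and
    increases on the nonnegative axis; evenness allows [0 <= x]. *)
Lemma cosh_le (R : realType) (x : R) :
  expR x + expR (- x) <= 2 * expR (x ^+ 2 / 2).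
Proof.
wlog x0 : x / 0 <= x.
  move=> H; have [/H//|x0] := leP 0 x.
  by move: (H (- x)); rewrite opprK sqrrN addrC; apply; rewrite oppr_ge0 ltW.
(* This is the sign condition on the derivative of [g]; it follows in the same way from [k 0 = 0]
   and [1 + 2 * y <= expR (2 * y)]. *)
have kP (y : R) : 0 <= y -> 1 - y <= (1 + y) * expR (- (2 * y)).
  move=> y0; rewrite -subr_ge0.
  pose k (y : R) := (1 + y) * expR (- (2 * y)) - (1 - y).
  have k0 : k 0 = 0 by rewrite /k mulr0 oppr0 expR0; ring.
  rewrite -k0.
  apply: (@ge0_derive_leT _ k
    (fun y => 1 - (1 + 2 * y) * expR (- (2 * y)))) => //.
    move=> w; rewrite /k; apply: is_derive_eq.
    by rewrite /GRing.scale/=; ring.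
  move=> w w0; rewrite subr_ge0 expRN ler_pdivrMr ?expR_gt0// mul1r.
  exact: expR_ge1Dx.
pose g (y : R) := 2 - expR (y - y ^+ 2 / 2) - expR (- y - y ^+ 2 / 2).
have : g 0 <= g x.
  apply: (@ge0_derive_leT _ g (fun y => (1 + y) * expR (- y - y ^+ 2 / 2)
     - (1 - y) * expR (y - y ^+ 2 / 2))) => // y.
    rewrite /g; apply: is_derive_eq.
    by rewrite /GRing.scale/=; field.
  move=> y0; rewrite subr_ge0.
  have -> : - y - y ^+ 2 / 2 = - (2 * y) + (y - y ^+ 2 / 2) by ring.
  by rewrite (expRD (- _)) mulrA ler_wpM2r ?expR_ge0// kP.
have -> : g 0 = 0 by rewrite /g expr0n mul0r oppr0 addr0 expR0; ring.
rewrite /g -addrA -opprD subr_ge0 !expRD -mulrDl (expRN (_ / _)).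
by rewrite ler_pdivrMr ?expR_gt0.
Qed.

(** * Averages over random signs and exponential moments of sign sums *)

(* The expectation of [f] over [N] independent uniform signs, given as a list. *)
Fixpoint sign_avg (R : realType) (N : nat) (f : seq R -> R) : R :=
  if N is N'.+1 then
    (sign_avg N' (fun l => f (1 :: l)) + sign_avg N' (fun l => f (-1 :: l))) / 2
  else f [::].

(** Entries past the end of [l] read as 0, so the sum makes sense for every list; those averaged by
    [sign_avg N] have length [N]. *)
Definition dot (R : realType) (N : nat) (w : 'I_N -> R) (l : seq R) : R :=
  \sum_(i < N) w i * l`_i.

Lemma sign_avg_le (R : realType) N (f g : seq R -> R) :
  (forall l, f l <= g l) -> sign_avg N f <= sign_avg N g.
Proof.
elim: N f g => [|N IH] f g fg /=; first exact: fg.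
by rewrite ler_pM2r ?invr_gt0// lerD// IH.
Qed.

Lemma sign_avgD (R : realType) N (f g : seq R -> R) :
  sign_avg N (fun l => f l + g l) = sign_avg N f + sign_avg N g.
Proof. by elim: N f g => [|N IH] f g //=; rewrite !IH; ring. Qed.

Lemma sign_avgZ (R : realType) N (a : R) (f : seq R -> R) :
  sign_avg N (fun l => a * f l) = a * sign_avg N f.
Proof. by elim: N f => [|N IH] f //=; rewrite !IH; ring. Qed.

Lemma sign_avg_cst (R : realType) N (a : R) : sign_avg N (fun=> a) = a.
Proof. by elim: N => [|N IH] //=; rewrite !IH; field. Qed.

Lemma sign_avg_sum (R : realType) N (K : finType) (f : K -> seq R -> R) :
  sign_avg N (fun l => \sum_k f k l) = \sum_k sign_avg N (f k).
Proof.
elim: N f => [|N IH] f //=.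
by rewrite !IH -big_split/= mulr_suml.
Qed.

(** Method of conditional expectations: each sign is fixed to the half with the smaller average. *)
Lemma le_sign_avg (R : realType) N (f : seq R -> R) :
  exists l, f l <= sign_avg N f.
Proof.
elim: N f => [|N IH] f /=; first by exists [::].
have [l1 h1] := IH (fun l => f (1 :: l)).
have [l2 h2] := IH (fun l => f (-1 :: l)).
set a := sign_avg _ _ in h1 *; set b := sign_avg _ _ in h2 *.
have [ab|ab] := leP a b.
  by exists (1 :: l1); lra.
by exists (-1 :: l2); lra.
Qed.

(* Averaging over the first sign turns [exp (lam * (c * s + t) ^ 2)] into at most
   [exp (lam * c ^ 2) * exp (lam' * t ^ 2)] with
   [lam' = lam * (1 + 2 * lam * c ^ 2)], so the bound follows by induction as long
   as the quadratic correction [9 / 4 * x ^ 2] absorbs the growth of [lam']. *)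
Lemma sign_avg_expR_sqr (R : realType) N (w : 'I_N -> R) (lam : R) :
  let x := lam * \sum_i w i ^+ 2 in `|x| <= 2 / 9 ->
  sign_avg N (fun l => expR (lam * dot w l ^+ 2)) <= expR (x + 9 / 4 * x ^+ 2).
Proof.
rewrite /dot; elim: N w lam => [|N IH] w lam /=.
  by rewrite !big_ord0 expr0n !mulr0 expr0n mulr0 addr0 expR0.
rewrite big_ord_recl /=.
set c := w ord0; set V := \sum_(i < N) _.
have V0 : 0 <= V by apply: sumr_ge0 => i _; exact: sqr_ge0.
move=> xle.
pose w' i := w (lift ord0 i).
pose lam' := lam * (1 + 2 * (lam * c ^+ 2)).
pose a := lam * c ^+ 2; pose y := lam * V.
have xE : lam * (c ^+ 2 + V) = a + y by rewrite mulrDr.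
have ay0 : 0 <= a * y.
  have -> : a * y = lam ^+ 2 * (c ^+ 2 * V) by rewrite /a /y; ring.
  by rewrite mulr_ge0 ?sqr_ge0// mulr_ge0 ?sqr_ge0.
have signs : (0 <= a /\ 0 <= y) \/ (a <= 0 /\ y <= 0).
  have [l0|l0] := leP 0 lam; [left|right].
    by split; apply: mulr_ge0 => //; exact: sqr_ge0.
  by split; apply: mulr_le0_ge0 => //; rewrite ?sqr_ge0// ltW.
rewrite xE in xle *.
(* The smallness hypothesis passes to [lam']: if [a] and [y] are nonnegative then [2 * a * y <= a],
   and if they are nonpositive then [1 + 2 * a] lies between 5/9 and 1. *)
have le' : `|lam' * \sum_i w' i ^+ 2| <= 2 / 9.
  have -> : lam' * \sum_i w' i ^+ 2 = y * (1 + 2 * a).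
    by rewrite /lam' /y /a /V /w'; ring.
  move: xle; rewrite !ler_norml => /andP[h1 h2].
  by apply/andP; case: signs => -[a0 y0]; split; nra.
(* [cosh_le] turns the cross term [2 * lam * c * t] into [2 * lam ^+ 2 * c ^+ 2 * t ^+ 2], which is
   the excess of [lam' * t ^+ 2] over [lam * t ^+ 2]. *)
have step (t : R) : expR (lam * (c * 1 + t) ^+ 2) + expR (lam * (c * -1 + t) ^+ 2)
   <= 2 * expR a * expR (lam' * t ^+ 2).
  have -> : lam * (c * 1 + t) ^+ 2 = a + lam * t ^+ 2 + 2 * lam * c * t.
    by rewrite /a; ring.
  have -> : lam * (c * -1 + t) ^+ 2 = a + lam * t ^+ 2 + - (2 * lam * c * t).
    by rewrite /a; ring.
  rewrite 2![expR (_ + lam * _ + _)]expRD -mulrDr.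
  apply: (le_trans (ler_wpM2l (expR_ge0 _) (cosh_le _))).
  rewrite mulrCA -[leRHS]mulrA -!expRD ler_pM2l// ler_expR le_eqVlt; apply/orP; left.
  by apply/eqP; rewrite /lam' /a; field.
rewrite -sign_avgD.
apply: (@le_trans _ _ (sign_avg N
  (fun l => 2 * expR a * expR (lam' * (\sum_(i < N) w' i * l`_i) ^+ 2)) / 2)).
  rewrite ler_pM2r ?invr_gt0//; apply: sign_avg_le => l.
  by rewrite !big_ord_recl /=; apply: step.
have := IH w' lam' le'.
have -> : lam' * \sum_i w' i ^+ 2 = y * (1 + 2 * a).
  by rewrite /lam' /y /a /V /w'; ring.
rewrite sign_avgZ; set X := sign_avg _ _ => hX.
have -> : 2 * expR a * X / 2 = expR a * X by field.
apply: (le_trans (ler_wpM2l (expR_ge0 a) hX)).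
rewrite -expRD ler_expR -subr_ge0.
(* The right exponent minus the left one is this product plus [9 / 4 * a ^+ 2]. The bracket is
   nonnegative since [9 * (1 + a) * y] is at most 22/9. *)
have : 0 <= a * y * (5 / 2 - 9 * (1 + a) * y).
  apply: mulr_ge0 => //; move: xle; rewrite ler_norml => /andP[h1 h2].
  by case: signs => -[a0 y0]; nra.
by have := sqr_ge0 a; lra.
Qed.

(** Jensen's inequality at [a], [b] and 0, the last with the leftover weight: the tangent of exp at
    the mean [z] lies below the graph. *)
Lemma expR_convex0 (R : realType) (al be a b : R) : 0 <= al -> 0 <= be ->
  al + be <= 1 ->
  expR (al * a + be * b) <= al * expR a + be * expR b + (1 - al - be).
Proof.
move=> al0 be0 ab1; set z := al * a + be * b.
have tangent y : expR z * (1 + (y - z)) <= expR y.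
  have {2}-> : y = z + (y - z) by ring.
  by rewrite [leRHS]expRD ler_pM2l ?expR_gt0// expR_ge1Dx.
have ha := ler_wpM2l al0 (tangent a).
have hb := ler_wpM2l be0 (tangent b).
have h0 : (1 - al - be) * (expR z * (1 + (0 - z))) <= (1 - al - be) * 1.
  by rewrite ler_wpM2l//; [lra|rewrite -[leRHS]expR0; exact: tangent].
have e : expR z = al * (expR z * (1 + (a - z))) + be * (expR z * (1 + (b - z)))
  + (1 - al - be) * (expR z * (1 + (0 - z))).
  by set E := expR z; rewrite /z; ring.
lra.
Qed.

(* When [al = 0] the weights [w] vanish and both sides are trivial. *)
Lemma sign_avg_expR_sqr_normalized (R : realType) N (w : 'I_N -> R) (lam : R) :
  let al := \sum_i w i ^+ 2 in `|lam| <= 2 / 9 ->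
  al * sign_avg N (fun l => expR (lam / al * dot w l ^+ 2 - lam)) <=
  al * expR (9 / 4 * lam ^+ 2).
Proof.
move=> al lamle; have [->|al0] := eqVneq al 0; first by rewrite !mul0r.
apply: ler_wpM2l; first by apply: sumr_ge0 => i _; exact: sqr_ge0.
have e : lam / al * al = lam by rewrite divfK.
have := @sign_avg_expR_sqr R N w (lam / al).
rewrite /= -/al e => /(_ lamle) h.
rewrite [leLHS](_ : _ = expR (- lam) *
    sign_avg N (fun l => expR (lam / al * dot w l ^+ 2))); last first.
  by rewrite -sign_avgZ; congr sign_avg; apply/funext => l; rewrite -expRD addrC.
apply: (le_trans (ler_wpM2l (expR_ge0 _) h)).
by rewrite -expRD addKr.
Qed.

Lemma dotD (R : realType) N (u v : 'I_N -> R) (a b : R) l :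
  dot (fun i => a * u i + b * v i) l = a * dot u l + b * dot v l.
Proof.
rewrite /dot !mulr_sumr -big_split/=; apply: eq_bigr => i _; ring.
Qed.

Lemma dot_eq0 (R : realType) N (w : 'I_N -> R) l :
  \sum_i w i ^+ 2 = 0 -> dot w l = 0.
Proof.
move/eqP; rewrite psumr_eq0; last by move=> i _; exact: sqr_ge0.
move/allP => w0; apply: big1 => i _.
have := w0 i (mem_index_enum i); rewrite sqrf_eq0 => /eqP ->.
by rewrite mul0r.
Qed.

(* Polarization writes the centred product as
   [al * (p ^ 2 / al - 1) - be * (q ^ 2 / be - 1)], where [p] and [q] are the
   sign sums of [(u + v) / 2] and [(u - v) / 2] and [al + be <= 1], so that
   convexity of exp reduces the claim to squares without any loss. *)
Lemma sign_avg_expR_dotM (R : realType) N (u v : 'I_N -> R) (lam : R) :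
  \sum_i u i ^+ 2 <= 1 -> \sum_i v i ^+ 2 <= 1 -> `|lam| <= 2 / 9 ->
  sign_avg N (fun l => expR (lam * (dot u l * dot v l - \sum_i u i * v i))) <=
  expR (9 / 4 * lam ^+ 2).
Proof.
move=> u1 v1 lamle; set c := \sum_i u i * v i.
pose p i := 2^-1 * u i + 2^-1 * v i; pose q i := 2^-1 * u i + - 2^-1 * v i.
pose al := \sum_i p i ^+ 2; pose be := \sum_i q i ^+ 2.
have al0 : 0 <= al by apply: sumr_ge0 => i _; exact: sqr_ge0.
have be0 : 0 <= be by apply: sumr_ge0 => i _; exact: sqr_ge0.
have albe1 : al + be <= 1.
  have -> : al + be = 2^-1 * (\sum_i u i ^+ 2 + \sum_i v i ^+ 2).
    rewrite /al /be -!big_split/= mulr_sumr; apply: eq_bigr => i _.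
    by rewrite /p /q; field.
  lra.
have cE : c = al - be.
  rewrite /al /be -sumrB; apply: eq_bigr => i _.
  by rewrite /p /q; field.
(* As [w / 0 = 0], the case [a = 0] needs [d = 0]; [dot_eq0] supplies this for vanishing weights. *)
have mulVK (a w d : R) : (a = 0 -> d = 0) -> a * (w / a * d ^+ 2) = w * d ^+ 2.
  have [->|a0 _] := eqVneq a 0; last by field.
  by move=> /(_ erefl) ->; rewrite expr0n/= !mulr0.
apply: (@le_trans _ _ (sign_avg N (fun l =>
   al * expR (lam / al * dot p l ^+ 2 - lam) +
   (be * expR ((- lam) / be * dot q l ^+ 2 - (- lam)) + (1 - al - be))))).
  apply: sign_avg_le => l; rewrite addrA.
  apply: le_trans (expR_convex0 _ _ al0 be0 albe1).
  rewrite ler_expR !(mulrBr al, mulrBr be) !mulVK; last 2 first.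
  - exact: dot_eq0.
  - exact: dot_eq0.
  rewrite le_eqVlt; apply/orP; left; apply/eqP.
  by rewrite !dotD cE; field.
rewrite 2!sign_avgD !sign_avgZ sign_avg_cst.
have hp := @sign_avg_expR_sqr_normalized R N p lam lamle.
have hq := @sign_avg_expR_sqr_normalized R N q (- lam).
rewrite normrN in hq; have {}hq := hq lamle; rewrite sqrrN in hq.
set B := expR (9 / 4 * _) in hp hq *.
have B1 : 1 <= B.
  by rewrite -expR0 ler_expR mulr_ge0 ?sqr_ge0.
have : (1 - al - be) * 1 <= (1 - al - be) * B by rewrite ler_wpM2l//; lra.
rewrite -/al -/be /= in hp hq *.
lra.
Qed.

(** * Derandomized projection of Gram matrices *)

(** The sum over [k] is the potential. One more random list multiplies each of its terms by at most
    [B] on average, so some list does so for the total. *)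
Lemma exists_signs_le (R : realType) N (K : finType) (X : K -> seq R -> R)
    (B : R) (r : nat) : 0 <= B ->
  (forall k, sign_avg N (fun l => expR (X k l)) <= B) ->
  exists L : nat -> seq R,
    \sum_k expR (\sum_(i < r) X k (L i)) <= #|K|%:R * B ^+ r.
Proof.
move=> B0 XB; elim: r => [|r [L hL]].
  exists (fun=> [::]); rewrite expr0 mulr1.
  rewrite (eq_bigr (fun=> 1)) => [|k _]; last by rewrite big_ord0 expR0.
  by rewrite sumr_const.
pose Phi k := expR (\sum_(i < r) X k (L i)).
have [l hl] := le_sign_avg N (fun l => \sum_k Phi k * expR (X k l)).
exists (fun i => if (i < r)%N then L i else l).
under eq_bigr => k _.
  rewrite big_ord_recr /= ltnn expRD.
  under eq_bigr => i _ do rewrite ltn_ord.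
  over.
apply: (le_trans hl); rewrite sign_avg_sum.
apply: (@le_trans _ _ (\sum_k Phi k * B)).
  by apply: ler_sum => k _; rewrite sign_avgZ ler_wpM2l// expR_ge0.
by rewrite -mulr_suml exprSr mulrA ler_wpM2r.
Qed.

Lemma low_rank_gram (R : realType) N n1 n2 (u : 'I_n1 -> 'I_N -> R)
    (v : 'I_n2 -> 'I_N -> R) (eps : R) (r : nat) :
  (0 < n1)%N -> (0 < n2)%N -> 0 < eps -> eps < 1 -> (0 < r)%N ->
  9 * ln (2 * n1%:R * n2%:R) <= r%:R * eps ^+ 2 ->
  (forall i, \sum_k u i k ^+ 2 <= 1) -> (forall j, \sum_k v j k ^+ 2 <= 1) ->
  exists G : 'M[R]_(n1, n2), (\rank G <= r)%N /\
    forall i j, `|G i j - \sum_k u i k * v j k| <= eps.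
Proof.
move=> n1_gt0 n2_gt0 e0 e1 r0 hr u1 v1.
(* This [lam] minimizes [(eps ^ 2 / 9 + 9 / 4 * lam ^ 2) / lam], with value [eps]. *)
pose lam := 2 / 9 * eps.
pose sg (b : bool) : R := (-1) ^+ b.
have lamE b : `|sg b * lam| = lam.
  by rewrite normrM normr_sign mul1r ger0_norm// mulr_ge0// ltW.
(* The boolean selects the upper or the lower deviation of an entry, whence the factor 2 in the
   logarithm. *)
pose X (k : 'I_n1 * 'I_n2 * bool) (l : seq R) : R :=
  sg k.2 * lam * (dot (u k.1.1) l * dot (v k.1.2) l
     - \sum_i u k.1.1 i * v k.1.2 i).
have [|k|L hL] := @exists_signs_le R N _ X (expR (9 / 4 * lam ^+ 2)) r.
- exact: expR_ge0.
- have -> : lam ^+ 2 = (sg k.2 * lam) ^+ 2.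
    by rewrite [RHS]exprMn /sg sqrr_sign mul1r.
  apply: sign_avg_expR_dotM => //.
  by rewrite lamE /lam; lra.
pose A := \matrix_(i < n1, k < r) dot (u i) (L k).
pose B := \matrix_(k < r, j < n2) dot (v j) (L k).
have rr : 0 < r%:R :> R by rewrite ltr0n.
exists (r%:R^-1 *: (A *m B)); split.
  apply: leq_trans (mxrank_scale _ _) _.
  by apply: leq_trans (mxrankM_maxl _ _) _; exact: rank_leq_col.
move=> i j; set c := \sum_k _.
pose S := \sum_(k < r) (dot (u i) (L k) * dot (v j) (L k) - c).
have -> : (r%:R^-1 *: (A *m B)) i j - c = r%:R^-1 * S.
  rewrite !mxE /S sumrB sumr_const card_ord.
  under eq_bigr => k _ do rewrite !mxE.
  by rewrite mulrBr -[c *+ r]mulr_natl mulKf// gt_eqF.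
(* One term of the potential is at most the whole, and [hr] bounds the number of terms by
   [expR (r%:R * eps ^+ 2 / 9)]. *)
have key b : sg b * S <= r%:R * eps.
  have : expR (sg b * lam * S) <= expR (r%:R * eps ^+ 2 / 9 + r%:R * (9 / 4 * lam ^+ 2)).
    rewrite [leRHS]expRD expRM_natl.
    apply: (le_trans _ (le_trans hL _)).
      rewrite (bigD1 (i, j, b))//= -[X in X <= _]addr0 lerD//.
        by rewrite /X /= -mulr_sumr.
      by apply: sumr_ge0 => k _; exact: expR_ge0.
    rewrite ler_wpM2r ?exprn_ge0 ?expR_ge0//.
    rewrite !card_prod !card_ord card_bool !natrM.
    rewrite -[leLHS]lnK ?ler_expR; last first.
      by rewrite posrE !mulr_gt0 ?ltr0n.
    rewrite (_ : n1%:R * n2%:R * 2 = 2 * n1%:R * n2%:R); last by ring.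
    lra.
  rewrite ler_expR.
  have -> : sg b * lam * S = lam * (sg b * S) by ring.
  have -> : r%:R * eps ^+ 2 / 9 + r%:R * (9 / 4 * lam ^+ 2) = lam * (r%:R * eps).
    by rewrite /lam; field.
  by rewrite ler_pM2l// /lam; lra.
have ir : 0 <= r%:R^-1 :> R by rewrite invr_ge0 ltW.
rewrite normrM (ger0_norm ir) ler_pdivrMl// ler_norml.
have := key true; have := key false; rewrite /sg expr0 expr1 mul1r mulN1r.
lra.
Qed.

(** * Entrywise powers of Gram matrices through tensor powers *)

Lemma sum_tensor_power (R : realType) m s (x z : 'I_m -> R) :
  \sum_(f : {ffun 'I_s -> 'I_m}) (\prod_a x (f a)) * (\prod_a z (f a)) =
  (\sum_k x k * z k) ^+ s.
Proof.
rewrite -[s in RHS]card_ord -prodr_const bigA_distr_bigA.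
by apply: eq_bigr => f _; rewrite big_split.
Qed.

(** Tensor powers scaled by [a^-1 ^+ s] and [b^-1 ^+ s] lie in the unit ball. The bound on [r] in
    [low_rank_gram] is independent of the dimension, here [m ^ s], so the same [r] serves every
    power. *)
Lemma low_rank_gram_power (R : realType) m n1 n2 (x : 'I_n1 -> 'I_m -> R)
    (z : 'I_n2 -> 'I_m -> R) (a b eps : R) (r s : nat) :
  (0 < n1)%N -> (0 < n2)%N -> 0 < eps -> eps < 1 -> (0 < r)%N ->
  9 * ln (2 * n1%:R * n2%:R) <= r%:R * eps ^+ 2 ->
  0 < a -> 0 < b ->
  (forall i, \sum_k x i k ^+ 2 <= a ^+ 2) ->
  (forall j, \sum_k z j k ^+ 2 <= b ^+ 2) ->
  exists G : 'M[R]_(n1, n2), (\rank G <= r)%N /\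
    forall i j, `|G i j - (\sum_k x i k * z j k) ^+ s| <= eps * (a * b) ^+ s.
Proof.
move=> n1_gt0 n2_gt0 e0 e1 r0 hr a0 b0 xa zb.
pose T : finType := {ffun 'I_s -> 'I_m}.
have sumT (F : T -> R) : \sum_(k < #|T|) F (enum_val k) = \sum_f F f.
  by rewrite -big_enum_val.
pose tens (w : 'I_m -> R) (c : R) (k : 'I_#|T|) :=
  c^-1 ^+ s * \prod_d w ((enum_val k : T) d).
have tensM w1 c1 w2 c2 : \sum_k tens w1 c1 k * tens w2 c2 k =
    (c1^-1 * c2^-1) ^+ s * (\sum_k w1 k * w2 k) ^+ s.
  rewrite -sum_tensor_power mulr_sumr -sumT; apply: eq_bigr => k _.
  by rewrite /tens exprMn mulrACA.
have tens1 w c : 0 < c -> \sum_k w k ^+ 2 <= c ^+ 2 ->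
    \sum_k tens w c k ^+ 2 <= 1.
  move=> c0 wc; under eq_bigr do rewrite expr2.
  rewrite tensM -exprMn; apply: exprn_ile1.
    rewrite mulr_ge0 ?mulr_ge0 ?invr_ge0 ?(ltW c0)//.
    by apply: sumr_ge0 => k _; rewrite -expr2 sqr_ge0.
  rewrite -invfM ler_pdivrMl ?mulr_gt0// mulr1 -expr2.
  by under eq_bigr do rewrite -expr2.
have [|i|j|G [rG hG]] := @low_rank_gram R _ n1 n2 (fun i => tens (x i) a)
  (fun j => tens (z j) b) eps r n1_gt0 n2_gt0 e0 e1 r0 => //.
- exact: tens1.
- exact: tens1.
have ab0 : 0 < (a * b) ^+ s by rewrite exprn_gt0// mulr_gt0.
exists ((a * b) ^+ s *: G); split; first exact: leq_trans (mxrank_scale _ _) _.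
move=> i j; have := hG i j; rewrite tensM mxE.
set S := (\sum_k _) ^+ s => h.
have -> : (a * b) ^+ s * G i j - S =
    (a * b) ^+ s * (G i j - (a^-1 / b) ^+ s * S).
  rewrite mulrBr mulrA -exprMn mulrACA !divff ?gt_eqF//.
  by rewrite mulr1 expr1n mul1r.
by rewrite normrM (gtr0_norm ab0) mulrC ler_pM2r.
Qed.

(** * Cauchy-Schwarz, the Euclidean norm and the spectral norm *)

Lemma sum_mul_sqr_le (R : realType) (I : finType) (a b : I -> R) :
  (\sum_i a i * b i) ^+ 2 <= (\sum_i a i ^+ 2) * (\sum_i b i ^+ 2).
Proof.
set S := \sum_i a i * b i; set A := \sum_i a i ^+ 2; set B := \sum_i b i ^+ 2.
have quad t : 0 <= A - 2 * t * S + t ^+ 2 * B.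
  have -> : A - 2 * t * S + t ^+ 2 * B = \sum_i (a i - t * b i) ^+ 2.
    rewrite /A /S /B !mulr_sumr -sumrB -big_split/=; apply: eq_bigr => i _; ring.
  by apply: sumr_ge0 => i _; exact: sqr_ge0.
have B0 : 0 <= B by apply: sumr_ge0 => i _; exact: sqr_ge0.
have A0 : 0 <= A by apply: sumr_ge0 => i _; exact: sqr_ge0.
have [B0'|Bn0] := eqVneq B 0.
  have [->|S0] := eqVneq S 0; first by rewrite expr0n mulr_ge0.
  (* With [B = 0] the quadratic is affine in [t]; this [t] gives it the negative value [- A - 2]. *)
  have := quad ((A + 1) / S); rewrite B0' mulr0 addr0.
  have -> : A - 2 * ((A + 1) / S) * S = - A - 2 by field.
  by move=> ?; exfalso; lra.
have Bp : 0 < B by rewrite lt_def Bn0.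
have := mulr_ge0 B0 (quad (S / B)).
have -> : B * (A - 2 * (S / B) * S + (S / B) ^+ 2 * B) = A * B - S ^+ 2.
  by field.
by rewrite subr_ge0.
Qed.

Lemma l2norm_ge0 (R : realType) m (x : 'cV[R]_m) : 0 <= l2norm x.
Proof. exact: sqrtr_ge0. Qed.

Lemma sqr_l2norm (R : realType) m (x : 'cV[R]_m) :
  l2norm x ^+ 2 = \sum_i x i 0 ^+ 2.
Proof. by rewrite sqr_sqrtr//; apply: sumr_ge0 => i _; exact: sqr_ge0. Qed.

Lemma l2normZ (R : realType) m (c : R) (x : 'cV[R]_m) : 0 <= c ->
  l2norm (c *: x) = c * l2norm x.
Proof.
move=> c0; rewrite /l2norm.
under eq_bigr => i _ do rewrite mxE exprMn.
by rewrite -mulr_sumr sqrtrM ?sqr_ge0// sqrtr_sqr ger0_norm.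
Qed.

Lemma l2norm_eq0 (R : realType) m (x : 'cV[R]_m) : l2norm x = 0 -> x = 0.
Proof.
move=> x0; have := sqr_l2norm x; rewrite x0 expr0n/= => /esym/eqP.
rewrite psumr_eq0 => [/allP h|i _]; last exact: sqr_ge0.
apply/colP => i; rewrite mxE; apply/eqP.
by have := h i (mem_index_enum i); rewrite sqrf_eq0.
Qed.

(** The Frobenius norm bounds the set in [spectral_norm], so that its [sup] is an upper bound. *)
Lemma l2norm_mulmx_le (R : realType) m n (A : 'M[R]_(m, n)) (x : 'cV[R]_n) :
  l2closed_ball 1 x -> l2norm (A *m x) <= Num.sqrt (\sum_i \sum_j A i j ^+ 2).
Proof.
move=> x1; apply: ler_wsqrtr; apply: ler_sum => i _; rewrite mxE.
apply: le_trans (sum_mul_sqr_le _ _) _.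
rewrite ler_piMr//; first by apply: sumr_ge0 => j _; exact: sqr_ge0.
by rewrite -sqr_l2norm exprn_ile1 ?l2norm_ge0.
Qed.

Lemma le_spectral_norm (R : realType) m n (A : 'M[R]_(m, n)) (x : 'cV[R]_n)
    (c : R) : 0 < c -> l2closed_ball c x ->
  l2norm (A *m x) <= spectral_norm A * c.
Proof.
move=> c0 xc; rewrite -ler_pdivrMr// mulrC.
have ci0 : 0 <= c^-1 by rewrite invr_ge0 ltW.
rewrite -l2normZ// scalemxAr; apply: ub_le_sup.
  by exists (Num.sqrt (\sum_i \sum_j A i j ^+ 2)) => _ [y y1 <-]; exact: l2norm_mulmx_le.
exists (c^-1 *: x) => //.
by rewrite /l2closed_ball/= l2normZ// ler_pdivrMl// mulr1.
Qed.

(** Positive definiteness forbids [W *m e = 0] for the all-ones vector [e]. Strict positivity makes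
    [nu * rho] a valid radius and forces [0 < t] in the theorem. *)
Lemma spectral_norm_gt0 (R : realType) m (W : 'M[R]_m) : (0 < m)%N ->
  symposdef W -> 0 < spectral_norm W.
Proof.
move=> m0 [_ W0]; pose e : 'cV[R]_m := const_mx 1.
have e0 : e != 0.
  apply/negP => /eqP/matrixP/(_ (Ordinal m0) 0); rewrite !mxE => /eqP.
  by rewrite oner_eq0.
have le0 : 0 < l2norm e.
  by rewrite lt_neqAle l2norm_ge0 andbT eq_sym; apply: contra e0 => /eqP/l2norm_eq0->.
have := le_spectral_norm W le0 (lexx _).
rewrite -ler_pdivrMr//; apply: lt_le_trans; rewrite divr_gt0//.
rewrite lt_neqAle l2norm_ge0 andbT eq_sym; apply/negP => /eqP/l2norm_eq0 We.
by have := W0 _ e0; rewrite -mulmxA We mulmx0 mxE ltxx.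
Qed.

(** * Taylor's formula with remainder bound, around 0 *)

Lemma is_derive_subZsub (R : realType) (f g h : R -> R) (c df dg dh x : R) :
  is_derive x 1 f df -> is_derive x 1 g dg -> is_derive x 1 h dh ->
  is_derive x 1 (fun y => f y - c * (g y - h y)) (df - c * (dg - dh)).
Proof.
move=> Df Dg Dh; apply: is_derive_eq.
by [].
Qed.

Lemma within_continuous_subZsub (R : realType) (A : set R) (f g h : R -> R)
    (c : R) :
  {within A, continuous f} -> {within A, continuous g} ->
  {within A, continuous h} ->
  {within A, continuous (fun y => f y - c * (g y - h y))}.
Proof.
move=> cf cg ch x; apply: cvgB; first exact: cf.
by apply: cvgM; [exact: cvg_cst|apply: cvgB; [exact: cg|exact: ch]].
Qed.

Lemma is_derive_divfact_exp (R : realType) (c : R) n (x : R) :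
  is_derive x 1 (fun y : R => c / n.+1`!%:R * y ^+ n.+1) (c / n`!%:R * x ^+ n).
Proof.
have H := is_deriveM (is_derive_cst (c / n.+1`!%:R) x 1)
  (is_deriveX n.+1 (is_derive_id x (1 : R))).
rewrite (_ : (fun _ => _) = (cst (c / n.+1`!%:R) : R -> R) * @id R ^+ n.+1).
  apply: (is_derive_eq H); rewrite /GRing.scale/= mulr0 addr0 mulr1.
  have n0 : n`!%:R != 0 :> R by rewrite pnatr_eq0 -lt0n fact_gt0.
  have n1 : n.+1%:R != 0 :> R by rewrite pnatr_eq0.
  rewrite factS natrM /=; move: (n`!%:R) (n.+1%:R) n0 n1 => p q p0 q0.
  by field; rewrite p0 q0.
by apply/funext => y; rewrite fctE exprfctE.
Qed.

Lemma is_derive_taylor_poly (R : realType) (a : nat -> R) n (x : R) :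
  is_derive x 1 (fun y : R => \sum_(k < n.+1) a k / k`!%:R * y ^+ k)
    (\sum_(k < n) a k.+1 / k`!%:R * x ^+ k).
Proof.
elim: n => [|n IH].
  rewrite big_ord0 (_ : (fun _ => _) = cst (a 0%N)); first exact: is_derive_cst.
  by apply/funext => y; rewrite big_ord1 expr0 mulr1 divr1.
rewrite (_ : (fun _ => _) = (fun y => \sum_(k < n.+1) a k / k`!%:R * y ^+ k) +
    (fun y => a n.+1 / (n.+1)`!%:R * y ^+ n.+1)); last first.
  by apply/funext => y; rewrite big_ord_recr.
rewrite big_ord_recr/=; apply: is_deriveD.
exact: is_derive_divfact_exp.
Qed.

(** [f k] plays the [k]-th derivative. Induction bounds the remainder of [f 1], and monotonicity
    integrates that bound from 0. *)
Lemma taylor_right (R : realType) (f : nat -> R -> R) (K : R) n (z : R) :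
  0 <= z ->
  (forall k, {within `[0, z], continuous (f k)}) ->
  (forall k (x : R), x \in `]0, z[ -> is_derive x 1 (f k) (f k.+1 x)) ->
  (forall x : R, x \in `[0, z] -> `|f n x| <= K) ->
  `|f 0%N z - \sum_(k < n) f k 0 / k`!%:R * z ^+ k| <= K / n`!%:R * z ^+ n.
Proof.
elim: n f z => [|n IH] f z z0 cf df fK.
  rewrite big_ord0 subr0 expr0 mulr1 divr1; apply: fK.
  by rewrite in_itv/= z0 lexx.
pose T y := \sum_(k < n.+1) f k 0 / k`!%:R * y ^+ k.
pose T' (y : R) := \sum_(k < n) f k.+1 0 / k`!%:R * y ^+ k.
have fT' (x : R) : x \in `]0, z[ -> `|f 1%N x - T' x| <= K / n`!%:R * x ^+ n.
  rewrite in_itv/= => /andP[x0 xz].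
  rewrite /T'; refine (IH (fun k => f k.+1) x _ _ _ _) => [|k|k y|y].
  - exact: ltW.
  - apply: continuous_subspaceW (cf k.+1) => y /=.
    by rewrite !in_itv/= => /andP[-> /le_trans]; apply; exact: ltW.
  - rewrite in_itv/= => /andP[y0 yx]; apply: df.
    by rewrite in_itv/= y0 (lt_trans yx).
  - rewrite in_itv/= => /andP[y0 yx]; apply: fK.
    by rewrite in_itv/= y0 (le_trans yx)// ltW.
have dpow (x : R) : is_derive x 1 (fun y : R => K / n.+1`!%:R * y ^+ n.+1)
    (K / n`!%:R * x ^+ n).
  exact: is_derive_divfact_exp.
have der_cont (g dg : R -> R) : (forall x : R, is_derive x 1 g (dg x)) ->
    {within `[0, z], continuous g}.
  move=> dgE; apply: continuous_subspaceT => x.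
  by apply: differentiable_continuous; apply/derivable1_diffP; case: (dgE x).
(* The signs [c = 1] and [c = -1] give the two halves of the absolute value; [g] is 0 at 0 with
   nonnegative derivative by [fT']. *)
have side (c : R) : `|c| = 1 -> 0 <= K / n.+1`!%:R * z ^+ n.+1 - c * (f 0%N z - T z).
  move=> c1.
  pose g y := K / n.+1`!%:R * y ^+ n.+1 - c * (f 0%N y - T y).
  rewrite -/(g z).
  have <- : g 0 = 0.
    rewrite /g /T expr0n/= mulr0 big_ord_recl big1 => [|i _].
      by rewrite expr0 divr1 addr0 mulr1 subrr mulr0 subrr.
    by rewrite expr0n mulr0.
  refine (@ge0_derive_le _ g
    (fun x => K / n`!%:R * x ^+ n - c * (f 1%N x - T' x)) z z0 _ _ _).
  - move=> x xz.
    have d := is_derive_subZsub c (dpow x) (df 0%N x xz)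
      (is_derive_taylor_poly (fun k => f k 0) n x).
    exact d.
  - exact (within_continuous_subZsub (der_cont _ _ dpow) (cf 0%N)
      (der_cont _ _ (is_derive_taylor_poly (fun k => f k 0) n))).
  - move=> x xz; rewrite subr_ge0 (le_trans (ler_norm _))//.
    by rewrite normrM c1 mul1r fT'.
rewrite -/(T z) ler_norml.
have := side 1; have := side (-1); rewrite normrN normr1 => /(_ erefl) h1 /(_ erefl) h2.
lra.
Qed.

Lemma is_deriveZ_compN (R : realType) (f : R -> R) (c df x : R) :
  is_derive (- x) 1 f df -> is_derive x 1 (fun y => c * f (- y)) (- (c * df)).
Proof.
move=> fE; have h : is_derive x 1 (fun y : R => f (- y)) (- df).
  apply: is_derive_eq (@is_derive1_comp _ f -%R x _ _ fE _) _.
  by rewrite mulrN1.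
have hc := is_deriveZ c h.
by apply: is_derive_eq; rewrite /GRing.scale/= mulrN.
Qed.

Lemma taylor_sym (R : realType) (f : nat -> R -> R) (K w b : R) n (z : R) :
  (forall k, {within `[- w, w], continuous (f k)}) ->
  (forall k (x : R), x \in `]- w, w[ -> is_derive x 1 (f k) (f k.+1 x)) ->
  (forall x : R, x \in `[- w, w] -> `|f n x| <= K) ->
  `|z| <= b -> b <= w ->
  `|f 0%N z - \sum_(k < n) f k 0 / k`!%:R * z ^+ k| <= K / n`!%:R * b ^+ n.
Proof.
move=> cf df fK; rewrite ler_norml => /andP[bz zb] bw.
have b0 : 0 <= b by lra.
have K0 : 0 <= K.
  by apply: (le_trans (normr_ge0 (f n 0))); apply: fK; rewrite in_itv/=; apply/andP; split; lra.
have Kn (y : R) : 0 <= y -> y <= b -> K / n`!%:R * y ^+ n <= K / n`!%:R * b ^+ n.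
  by move=> y0 yb; apply: ler_wpM2l; [exact: divr_ge0|exact: lerXn2r].
have [z0|z0] := leP 0 z.
  have H := @taylor_right _ f K n z z0.
  apply: (le_trans _ (Kn z z0 zb)); apply H => [k|k x|x].
  - apply: continuous_subspaceW (cf k) => y /=; rewrite !in_itv/= => /andP[? ?].
    by apply/andP; split; lra.
  - rewrite in_itv/= => /andP[? ?]; apply: df; rewrite in_itv/=.
    by apply/andP; split; lra.
  - rewrite in_itv/= => /andP[? ?]; apply: fK; rewrite in_itv/=.
    by apply/andP; split; lra.
(* Reflection reduces [z < 0] to [taylor_right]: the factor [(-1) ^+ k] makes [g k.+1] the
   derivative of [g k]. *)
pose g k (x : R) := (-1) ^+ k * f k (- x).
have -> : f 0%N z - \sum_(k < n) f k 0 / k`!%:R * z ^+ k =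
    g 0%N (- z) - \sum_(k < n) g k 0 / k`!%:R * (- z) ^+ k.
  rewrite /g expr0 mul1r opprK oppr0; congr (_ - _); apply: eq_bigr => k _.
  rewrite (exprNn z); have := sqrr_sign R k; rewrite expr2.
  set s := (-1) ^+ k => ss.
  by rewrite -[LHS]mul1r -ss; ring.
have nz0 : 0 <= - z by rewrite oppr_ge0 ltW.
have nzb : - z <= b by rewrite lerNl.
have H := @taylor_right _ g K n (- z) nz0.
apply: (le_trans _ (Kn _ nz0 nzb)); apply H => [k|k x|x].
- apply/subspace_continuousP => x; rewrite /= in_itv/= => /andP[x0 xz].
  apply: cvgZr => /=.
  have /subspace_continuousP/(_ (- x)) := cf k.
  rewrite /= in_itv/= => cx.
  have {}cx : f k y @[y --> within `[- w, w] (nbhs (- x))] --> f k (- x).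
    by apply: cx; apply/andP; split; lra.
  move=> P /cx; rewrite /nbhs/= /within/= => nP.
  have : \forall y \near x, (- y) \in `[- w, w] -> P (f k (- y)).
    have oppx : - y @[y --> x] --> - x by apply: cvgN; exact: cvg_id.
    exact: (oppx _ nP).
  apply: filterS => y yP; rewrite /= in_itv/= => /andP[y0 yz]; apply: yP.
  by rewrite in_itv/=; apply/andP; split; lra.
- rewrite in_itv/= => /andP[x0 xz].
  have fk : is_derive (- x) 1 (f k) (f k.+1 (- x)).
    by apply: df; rewrite in_itv/=; apply/andP; split; lra.
  have -> : g k.+1 x = - ((-1) ^+ k * f k.+1 (- x)) by rewrite /g exprS mulN1r mulNr.
  exact: is_deriveZ_compN.
- rewrite in_itv/= => /andP[x0 xz].
  rewrite normrM normr_sign mul1r; apply: fK.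
  by rewrite in_itv/=; apply/andP; split; lra.
Qed.

(** * From derivatives relative to [Omega] to ordinary ones *)

Lemma derivable_on_cvg (R : realType) (Omega : set R) (f : R -> R) (x : R) :
  derivable_on Omega f x -> f y @[y --> within Omega x^'] --> f x.
Proof.
move=> df.
have e : f = (fun y => diff_quot f x y * (y - x) + f x).
  apply/funext => y; rewrite /diff_quot; have [->|yx] := eqVneq y x.
    by rewrite (subrr x) mulr0 add0r.
  by rewrite divfK ?subrK// subr_eq0.
have cyx : y - x @[y --> within Omega x^'] --> x - x.
  apply: cvg_within_filter; apply: cvg_within_filter.
  by apply: cvgB; [exact: cvg_id|exact: cvg_cst].
have c := cvgD (cvgM df cyx) (cvg_cst (f x)).
rewrite subrr mulr0 add0r in c.
by rewrite [X in X @ _]e; exact: c.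
Qed.

Lemma derivable_on_within (R : realType) (Omega A : set R) (f : R -> R) :
  A `<=` Omega -> (forall x, Omega x -> derivable_on Omega f x) ->
  {within A, continuous f}.
Proof.
move=> AO df; apply/subspace_continuousP => x /AO Ox P fP.
have nP : nbhs x (fun y => y != x -> Omega y -> P (f y)).
  exact: derivable_on_cvg (df x Ox) _ fP.
suff : nbhs x (fun y => A y -> P (f y)) by [].
apply: filterS nP => y yP Ay.
have [->|yx] := eqVneq y x; first exact: nbhs_singleton fP.
by apply: yP => //; exact: AO.
Qed.

(** Near an interior point the restriction to [Omega] disappears, and the substitution [y = h + x]
    gives the usual quotient. *)
Lemma derive_on_is_derive (R : realType) (Omega : set R) (f : R -> R) (x : R) :
  nbhs x Omega -> derivable_on Omega f x ->
  is_derive x 1 f (derive_on Omega f x).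
Proof.
move=> xO df.
have shift0 : h + x @[h --> (0 : R)^'] --> within Omega x^'.
  move=> P; rewrite /nbhs/= /within/= /dnbhs /within/= => nP.
  have {}nP : nbhs x (fun y => y != x -> P y).
    by apply: filterS2 xO nP => y Oy yP yx; exact: yP.
  have c : h + x @[h --> (0 : R)] --> x.
    by rewrite -[X in _ --> X]add0r; apply: cvgD; [exact: cvg_id|exact: cvg_cst].
  have {}nP : nbhs (0 : R) (fun h => h + x != x -> P (h + x)) := c _ nP.
  suff : nbhs (0 : R) (fun h => h != 0 -> P (h + x)) by [].
  apply: filterS nP => h hP h0; apply: hP.
  by rewrite -subr_eq0 addrK.
have l : h^-1 *: ((f \o shift x) (h *: 1) - f x) @[h --> (0 : R)^'] -->
    derive_on Omega f x.
  have := cvg_comp _ _ shift0 df.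
  apply: cvg_trans; apply: near_eq_cvg; near=> h => /=.
  by rewrite /diff_quot addrK /GRing.scale/= mulr1 mulrC.
apply: DeriveDef; first by apply/cvg_ex; exists (derive_on Omega f x).
exact: cvg_lim l.
Unshelve. all: by end_near.
Qed.

Lemma Linfty_norm_le (R : realType) (Omega : set R) (g : R -> R) (B x : R) :
  (Linfty_norm Omega g <= B%:E)%E -> Omega x -> `|g x| <= B.
Proof.
move=> gB Ox; rewrite -lee_fin; apply: le_trans gB.
by apply: ereal_sup_ubound; exists x.
Qed.

(** The points [- w] and [w] may be endpoints of [Omega], so relative derivatives give continuity on
    the closed interval and ordinary derivatives on the open one. *)
Lemma smooth_on_taylor (R : realType) (Omega : set R) (h : R -> R)
    (C M w b z : R) n :
  0 < w -> `[- w, w] `<=` Omega -> smooth_on Omega h ->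
  (forall s : nat,
    (Linfty_norm Omega (derive_onn Omega s h) <= (C * M ^+ s)%:E)%E) ->
  `|z| <= b -> b <= w ->
  `|h z - \sum_(k < n) derive_onn Omega k h 0 / k`!%:R * z ^+ k| <=
    C * M ^+ n / n`!%:R * b ^+ n.
Proof.
move=> w0 wO sm hb zb bw.
apply: (@taylor_sym R (fun k => derive_onn Omega k h) (C * M ^+ n) w b n z _ _ _ zb bw).
- by move=> k; apply: derivable_on_within wO _ => x; exact: sm.
- move=> k x xw; apply: derive_on_is_derive; last first.
    by apply: sm; apply: wO; apply: subset_itv_oo_cc.
  apply: filterS (near_in_itvoo xw) => y yw.
  by apply: wO; apply: subset_itv_oo_cc.
- by move=> x xw; apply: Linfty_norm_le (hb n) _; exact: wO.
Qed.

(** * Exponential series estimates and the rank of a sum *)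

Lemma sum_exp_coeff_le (R : realType) (x : R) n : 0 <= x ->
  \sum_(k < n) x ^+ k / k`!%:R <= expR x.
Proof.
move=> x0; have := @nondecreasing_cvgn_le R (series (exp_coeff x)) _
  (is_cvg_series_exp_coeff x) n.
rewrite /series/= /exp_coeff/= big_mkord; apply.
by apply: nondecreasing_series => i _ _; exact: exp_coeff_ge0.
Qed.

(** A single term of the series gives [n ^ n / n! <= exp n]; since [x <= exp (- 2) * n], the product
    is at most [exp (- 2 * n) * exp n]. *)
Lemma pow_div_fact_le (R : realType) (x : R) n : 0 <= x ->
  expR 1 ^+ 2 * x <= n%:R -> x ^+ n / n`!%:R <= expR (- n%:R).
Proof.
move=> x0 xn.
have nfact : n%:R ^+ n / n`!%:R <= expR n%:R :> R.
  apply: le_trans (sum_exp_coeff_le n.+1 (ler0n _ n)).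
  rewrite big_ord_recr/= lerDr; apply: sumr_ge0 => k _.
  by rewrite divr_ge0// exprn_ge0.
have xle : x <= expR (- 2) * n%:R.
  rewrite expRN mulrC ler_pdivlMr ?expR_gt0//.
  by rewrite (_ : 2 = 2%:R * 1) ?expRM_natl ?mulr1// mulrC.
apply: (@le_trans _ _ (expR (- 2) ^+ n * (n%:R ^+ n / n`!%:R))).
  rewrite mulrA -exprMn ler_wpM2r ?invr_ge0//.
  by apply: lerXn2r => //; rewrite nnegrE// mulr_ge0// expR_ge0.
apply: (le_trans (ler_wpM2l (exprn_ge0 _ (expR_ge0 _)) nfact)).
rewrite -expRM_natr -expRD ler_expR; lra.
Qed.

Lemma rank_sum_le (F : fieldType) m n (I : finType) (A : I -> 'M[F]_(m, n)) r :
  (forall i, \rank (A i) <= r)%N -> (\rank (\sum_i A i)%R <= #|I| * r)%N.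
Proof.
move=> Ar; apply: (@leq_trans (\sum_i \rank (A i))).
  elim/big_ind2: _ => [|B b B' b' hB hB'|//]; first by rewrite mxrank0.
  by apply: leq_trans (mxrank_add _ _) _; exact: leq_add.
by rewrite -sum_nat_const; apply: leq_sum.
Qed.

(** * Assembly of the approximant and its error *)

Theorem theorem3p8 (R : realType) (eps : R) (n1 n2 : nat) (r : int)
  (sigma rho : R) (Omega : set R) (h : R -> R) (C M : R)
  (m : nat) (W : 'M[R]_m) :
  0 < eps -> eps < 1 ->
  (0 < n1)%N -> (0 < n2)%N ->
  r = Num.ceil (9 * ln (3 * n1%:R * n2%:R) / eps ^+ 2) ->
  0 < sigma -> 0 < rho ->
  is_interval Omega ->
  `[- (sigma * rho ^+ 2), sigma * rho ^+ 2] `<=` Omega ->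
  [bounded h x | x in Omega] ->
  smooth_on Omega h ->
  0 <= C -> 0 < M ->
  (forall s : nat,
    (Linfty_norm Omega (derive_onn Omega s h) <= (C * M ^+ s)%:E)%E) ->
  (0 < m)%N ->
  symposdef W ->
  spectral_norm W <= sigma ->
  forall (F : 'M[R]_(n1, n2)) (x : 'I_n1 -> 'cV[R]_m) (y : 'I_n2 -> 'cV[R]_m),
    (forall i, l2closed_ball rho (x i)) ->
    (forall j, l2closed_ball rho (y j)) ->
    (forall i j, F i j = h (((x i)^T *m W *m y j) 0 0)) ->
  forall t : int,
    expR 1 ^+ 2 * M * spectral_norm W * rho ^+ 2 <= t%:~R ->
  exists G : 'M[R]_(n1, n2),
    (\rank G)%:Z <= 1 + (t - 1) * r /\
    mx_norm (F - G) <=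
      C * (expR (- t%:~R) +
           eps * (expR (M * spectral_norm W * rho ^+ 2) - 1)).
Proof.
move=> eps0 eps1 n1_gt0 n2_gt0 rE sig0 rho0 _ wO _ sm C0 M0 hb m_gt0 Wpos Wsig.
move=> F x y xrho yrho FE t ht.
set nu := spectral_norm W in Wsig ht *.
have nu0 : 0 < nu by exact: spectral_norm_gt0.
pose kap := nu * rho ^+ 2; have kap0 : 0 < kap by rewrite mulr_gt0// exprn_gt0.
have kapE : M * nu * rho ^+ 2 = M * kap by rewrite /kap mulrA.
rewrite kapE; rewrite -(mulrA _ nu) -/kap -(mulrA _ M) in ht.
have e2 : 0 < expR 1 ^+ 2 :> R by rewrite exprn_gt0// expR_gt0.
have t_gt0 : 0 < t.
  by rewrite -(ltr0z R); apply: lt_le_trans ht; rewrite !mulr_gt0.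
(* Now [t = T.+1], so the Taylor polynomial has degree [T = t - 1]. *)
case: t t_gt0 ht => [[//|T]|//] _ ht.
have lnle : ln (2 * n1%:R * n2%:R) <= ln (3 * n1%:R * n2%:R) :> R.
  rewrite ler_ln ?posrE ?mulr_gt0 ?ltr0n// -!mulrA.
  by rewrite ler_pM2r ?mulr_gt0 ?ltr0n// ler_nat.
have ln0 : 0 < ln (3 * n1%:R * n2%:R) :> R.
  rewrite ln_gt0// -!natrM ltr1n -mulnA; apply: (@leq_trans (3 * 1)%N) => //.
  by rewrite leq_mul2l muln_gt0 n1_gt0.
have rge := ceil_ge (9 * ln (3 * n1%:R * n2%:R) / eps ^+ 2); rewrite -rE in rge.
have r_gt0 : 0 < r.
  rewrite -(ltr0z R); apply: lt_le_trans rge.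
  by rewrite divr_gt0 ?exprn_gt0// mulr_gt0.
case: r r_gt0 rge {rE} => [r|//]; rewrite ltz_nat => r_gt0 rge.
have hr : 9 * ln (2 * n1%:R * n2%:R) <= r%:R * eps ^+ 2.
  rewrite ler_pdivrMr ?exprn_gt0// in rge.
  by apply: le_trans rge; rewrite ler_pM2l.
pose p i j : R := \sum_k x i k 0 * (W *m y j) k 0.
have pE i j : ((x i)^T *m W *m y j) 0 0 = p i j.
  by rewrite -mulmxA mxE; apply: eq_bigr => k _; rewrite mxE.
have x2 i : \sum_k x i k 0 ^+ 2 <= rho ^+ 2.
  rewrite -sqr_l2norm lerXn2r ?nnegrE ?l2norm_ge0 ?(ltW rho0)//.
  exact: xrho.
have Wy2 j : \sum_k (W *m y j) k 0 ^+ 2 <= (nu * rho) ^+ 2.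
  rewrite -sqr_l2norm lerXn2r ?nnegrE ?l2norm_ge0//.
    by rewrite mulr_ge0// ltW.
  exact: le_spectral_norm (yrho j).
have kapE2 : rho * (nu * rho) = kap by rewrite /kap; ring.
have p_le i j : `|p i j| <= kap.
  rewrite -(@ler_pXn2r _ 2%N)// ?nnegrE ?(ltW kap0)// real_normK ?num_real//.
  apply: (le_trans (sum_mul_sqr_le _ _)).
  rewrite -kapE2 exprMn; apply: ler_pM => //;
  by apply: sumr_ge0 => k _; exact: sqr_ge0.
have [G hG] := choice (fun s : nat => @low_rank_gram_power R m n1 n2
  (fun i k => x i k 0) (fun j k => (W *m y j) k 0) rho (nu * rho) eps r s
  n1_gt0 n2_gt0 eps0 eps1 r_gt0 hr rho0 (mulr_gt0 nu0 rho0) x2 Wy2).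
pose a k := derive_onn Omega k h 0 / k`!%:R.
have w0 : 0 < sigma * rho ^+ 2 by rewrite mulr_gt0// exprn_gt0.
have O0 : Omega 0.
  by apply: wO; rewrite /= in_itv/= oppr_le0 ltW.
have a_le k : `|a k| <= C * M ^+ k / k`!%:R.
  rewrite /a normrM [X in _ * X]ger0_norm ?invr_ge0//.
  by rewrite ler_wpM2r ?invr_ge0//; exact: Linfty_norm_le (hb k) O0.
(* The constant term is exact and has rank at most 1; each of the [T] higher powers adds at most
   [r]. *)
exists (a 0%N *: const_mx 1 + \sum_(k < T) a k.+1 *: G k.+1); split.
  have -> : 1 + (T.+1%:Z - 1) * r%:Z = (1 + T * r)%N%:Z.
    by rewrite PoszD PoszM -addn1 PoszD addrK.
  rewrite lez_nat; apply: (leq_trans (mxrank_add _ _)); apply: leq_add.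
    apply: (leq_trans (mxrank_scale _ _)).
    rewrite (_ : const_mx 1 = (const_mx 1 : 'cV_n1) *m (const_mx 1 : 'rV[R]_n2)).
      by apply: (leq_trans (mxrankM_maxl _ _)); exact: rank_leq_col.
    by apply/matrixP => i j; rewrite !mxE big_ord1 !mxE mulr1.
  rewrite -[T in (_ <= T * _)%N]card_ord; apply: rank_sum_le => k.
  apply: (leq_trans (mxrank_scale _ _)); exact: (hG k.+1).1.
(* [mx_norm] is a maximum started at 0, so the bound itself must be nonnegative. *)
set B := C * _; have B0 : 0 <= B.
  rewrite mulr_ge0// addr_ge0 ?expR_ge0// mulr_ge0 ?(ltW eps0)//.
  by rewrite subr_ge0 -[leLHS]expR0 ler_expR mulr_ge0// ltW.
rewrite mx_normrE; apply: bigmax_le => // -[i j] _ /=.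
have taylor := @smooth_on_taylor R Omega h C M (sigma * rho ^+ 2) kap (p i j)
  T.+1 w0 wO sm hb (p_le i j).
have {}taylor : `|h (p i j) - \sum_(k < T.+1) a k * p i j ^+ k| <=
    C * expR (- T.+1%:R).
  apply: (le_trans (taylor _)).
    by rewrite ler_pM2r ?exprn_gt0.
  have -> : C * M ^+ T.+1 / T.+1`!%:R * kap ^+ T.+1 =
      C * ((M * kap) ^+ T.+1 / T.+1`!%:R).
    rewrite [in RHS]exprMn; move: (M ^+ _) (kap ^+ _) (_`!%:R^-1) => u v q; ring.
  apply: ler_wpM2l => //; apply: pow_div_fact_le; last exact: ht.
  by rewrite mulr_ge0 ?(ltW M0) ?(ltW kap0).
have tail : `|\sum_(k < T) a k.+1 * (G k.+1 i j - p i j ^+ k.+1)| <=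
    C * (eps * (expR (M * kap) - 1)).
  apply: (le_trans (ler_norm_sum _ _ _)).
  apply: (@le_trans _ _ (\sum_(k < T)
    C * (eps * ((M * kap) ^+ k.+1 / k.+1`!%:R)))).
    apply: ler_sum => k _; rewrite normrM.
    have := (hG k.+1).2 i j; rewrite kapE2 => hk.
    apply: (le_trans (ler_pM (normr_ge0 _) (normr_ge0 _) (a_le k.+1) hk)).
    rewrite [in leRHS]exprMn le_eqVlt; apply/orP; left; apply/eqP.
    move: (M ^+ _) (kap ^+ _) (_`!%:R^-1) => u v q; ring.
  rewrite -mulr_sumr ler_wpM2l// -mulr_sumr ler_pM2l//.
  (* The sum starts at the first power; moving the 1 across restores the zeroth term of the
     exponential series. *)
  rewrite lerBrDl.
  have := @sum_exp_coeff_le R (M * kap) T.+1 (mulr_ge0 (ltW M0) (ltW kap0)).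
  by rewrite big_ord_recl expr0 divr1.
rewrite !mxE summxE FE pE.
under eq_bigr => k _ do rewrite mxE.
(* The error splits into the Taylor remainder and the projection errors of the powers from 1 to
   [T]. *)
have -> : h (p i j) - (a 0%N * 1 + \sum_(k < T) a k.+1 * G k.+1 i j) =
    (h (p i j) - \sum_(k < T.+1) a k * p i j ^+ k) -
    \sum_(k < T) a k.+1 * (G k.+1 i j - p i j ^+ k.+1).
  rewrite big_ord_recl expr0.
  under [X in _ = _ - X]eq_bigr => k _ do rewrite mulrBr.
  rewrite sumrB; set s1 := \sum_(k < T) _; set s2 := \sum_(k < T) _.
  by rewrite /bump/=; ring.
apply: (le_trans (ler_normB _ _)).
by rewrite /B mulrDr lerD.
Qed.
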